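(* Let $T,N\in\mathbb N$ and let $\mu^1,\dots,\mu^N$ be Borel probability measures on $\mathbb R^T$ such that for each $i$ the canonical process $X^i$ is an $(\mathbb F^i,\mu^i)$-martingale and the market consisting of $X^i$ is complete. Let $\xi:\mathbb R^{T\cdot N}\to\mathbb R$ be measurable and such that there exist $f^i\in\mathbb L^1(\mu^i)$, $i\in\{1,\dots,N\}$, with $\xi(x^1,\dots,x^N)\le\sum_{i=1}^Nf^i(x^i)$. Then $$p(\xi)=\sup_{\mathbb P\in\mathrm{Cpl}_{\mathrm{mc}}(\mu^1,\dots,\mu^N)}\mathbb E^{\mathbb P}[\xi].$$
   Context: $X^i=(X^i_t)_{t=1}^T$ is the canonical process on $\mathbb R^T$, $\mathbb F^i$ its canonical filtration, with $\mathcal F^i_0$ trivial; $X^i_0:=x^i_0:=\mathbb E^{\mu^i}[X^i_1]$. Completeness of the market consisting of $X^i$: for every $(\mathbb F^i,\mu^i)$-martingale $M^i$ there is an $\mathbb F^i$-adapted real process $\Delta^i=(\Delta^i_t)_{t=0}^{T-1}$ with $M^i_t=m^i_0+\sum_{s=1}^t\Delta^i_{s-1}(X^i_s-X^i_{s-1})$ $\mu^i$-a.s. for all $t\in\{0,\dots,T\}$, where $M^i_0=m^i_0:=\mathbb E^{\mu^i}[M^i_1]$. $\mathbf X=(X^1,\dots,X^N)$ is the $\mathbb R^N$-valued canonical process on $\mathbb R^{T\cdot N}$ (with $\mathbf X_0=(x^1_0,\dots,x^N_0)$) and $\mathbb F^{\mathbf X}$ its filtration ($\mathcal F^{\mathbf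 X}_0$ trivial). $\mathrm{Cpl}_{\mathrm{mc}}(\mu^1,\dots,\mu^N)$ is the set of multicausal couplings: Borel probability measures $\pi$ on $(\mathbb R^T)^N$ with marginals $\mu^1,\dots,\mu^N$ such that for every $i$ and $t\in\{1,\dots,T\}$, under $\pi$, $(X^i_1,\dots,X^i_T)$ is independent of $\{(X^j_1,\dots,X^j_t):j\ne i\}$ given $(X^i_1,\dots,X^i_t)$. A statement holds $\mathrm{Cpl}_{\mathrm{mc}}$-quasi-surely (q.s.) if it holds outside a Borel set that is null for all $\pi\in\mathrm{Cpl}_{\mathrm{mc}}(\mu^1,\dots,\mu^N)$. $\mathcal A$ is the set of $\mathbb F^{\mathbf X}$-adapted $\mathbb R^N$-valued processes $\mathbf\Delta=(\mathbf\Delta_t)_{t=0}^{T-1}$ on $\mathbb R^{T\cdot N}$. The superhedging price is $$p(\xi):=\inf\Big\{p_0\in\mathbb R\ \Big|\ \exists\,\mathbf\Delta\in\mathcal A:\ p_0+\sum_{t=1}^T\mathbf\Delta_{t-1}\cdot(\mathbf X_t-\mathbf X_{t-1})\ge\xi(\mathbf X)\ \ \mathrm{Cpl}_{\mathrm{mc}}(\mu^1,\dots,\mu^N)\text{-q.s.}\Big\}.$$ *)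

(* Defs.v *)
From HB Require Import structures.
From mathcomp Require Import all_boot all_order all_algebra.
From mathcomp Require Import all_classical all_reals all_analysis.

Set Implicit Arguments.
Unset Strict Implicit.
Unset Printing Implicit Defensive.

Import Order.TTheory GRing.Theory Num.Theory.
Import numFieldNormedType.Exports.

Local Open Scope classical_set_scope.
Local Open Scope ring_scope.

(* Sub-sigma-algebras of a measurable space [Om] are represented as set systems
[G : set_system Om]; processes as functions [nat -> Om -> U] of which only the
values at the times under consideration matter. *)

Definition sub_measurable d (Om : Type) (U : measurableType d)
    (G : set_system Om) (f : Om -> U) : Prop :=
  forall B, measurable B -> G (f @^-1` B).

(* sigma(X_i : i in D) *)
Definition sigma_of (I Om : Type) (R : realType) (D : set I)
    (X : I -> Om -> R) : set_system Om :=
  <<s \bigcup_(i in D) preimage_set_system setT (X i) measurable >>.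

(* g is a version of E^P[f | G] *)
Definition is_condexp d (Om : measurableType d) (R : realType)
    (P : probability Om R) (G : set_system Om) (f g : Om -> R) : Prop :=
  [/\ sub_measurable G g,
      P.-integrable setT (EFin \o g) &
      forall A, G A ->
        (\int[P]_(w in A) (g w)%:E = \int[P]_(w in A) (f w)%:E)%E].

(* P(A n B | G) = P(A | G) P(B | G) P-a.s. for all A in F1 and B in F2 *)
Definition cond_independent d (Om : measurableType d) (R : realType)
    (P : probability Om R) (F1 F2 G : set_system Om) : Prop :=
  forall A B, F1 A -> F2 B -> exists a b : Om -> R,
    [/\ is_condexp P G \1_A a,
        is_condexp P G \1_B b &
        is_condexp P G \1_(A `&` B) (a \* b)].

Definition is_martingale d (Om : measurableType d) (R : realType)
    (P : probability Om R) (F : nat -> set_system Om) (T : nat)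
    (M : nat -> Om -> R) : Prop :=
  (forall t, (1 <= t <= T)%N ->
     sub_measurable (F t) (M t) /\ P.-integrable setT (EFin \o M t)) /\
  (forall s t, (1 <= s <= t)%N -> (t <= T)%N ->
     is_condexp P (F s) (M t) (M s)).

(* Extension of a process (M_t), 1 <= t <= T, to time 0 by M_0 := E^P[M_1]. *)
Definition from0 d (Om : measurableType d) (R : realType)
    (P : probability Om R) (M : nat -> Om -> R) (t : nat) (w : Om) : R :=
  if t is 0 then fine 'E_P[M 1%N] else M t w.

(* X_t for t = 1, ..., T: tuples are indexed from 0. The value at t = 0 is
   junk; X_0 is supplied by [from0]. *)
Definition canonical_process (R : realType) (T : nat) (t : nat) (x : T.-tuple R) : R :=
  x`_t.-1.

Definition canonical_filtration (R : realType) (T t : nat) :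
    set_system (T.-tuple R) :=
  sigma_of [set s | (1 <= s <= t)%N] (@canonical_process R T).

Definition complete_market (R : realType) (T : nat)
    (mu : probability (T.-tuple R) R) : Prop :=
  let X := from0 mu (@canonical_process R T) in
  forall M, is_martingale mu (@canonical_filtration R T) T M ->
  exists Delta : nat -> T.-tuple R -> R,
    (forall t, (t < T)%N -> sub_measurable (canonical_filtration t) (Delta t)) /\
    (forall t, (t <= T)%N ->
       {ae mu, forall x, from0 mu M t x =
          fine 'E_mu[M 1%N] +
          \sum_(1 <= s < t.+1) Delta s.-1 x * (X s x - X s.-1 x)}).

(* sigma(X^i_s : (i, s) in D) *)
Definition info (R : realType) (T N : nat) (D : set ('I_N * nat)) :
    set_system (N.-tuple (T.-tuple R)) :=
  sigma_of D (fun k x => canonical_process k.2 (tnth x k.1)).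

Definition multicausal (R : realType) (T N : nat)
    (P : probability (N.-tuple (T.-tuple R)) R) : Prop :=
  forall (i : 'I_N) t, (1 <= t <= T)%N ->
    cond_independent P
      (info [set k | k.1 = i /\ (1 <= k.2 <= T)%N])
      (info [set k | k.1 <> i /\ (1 <= k.2 <= t)%N])
      (info [set k | k.1 = i /\ (1 <= k.2 <= t)%N]).

Definition Cpl_mc (R : realType) (T N : nat)
    (mu : 'I_N -> probability (T.-tuple R) R) :
    set (probability (N.-tuple (T.-tuple R)) R) :=
  [set P : probability (N.-tuple (T.-tuple R)) R |
           (forall i A, measurable A ->
               pushforward P (fun x => tnth x i) A = mu i A) /\
            multicausal P].

Definition quasi_surely (R : realType) (T N : nat)
    (mu : 'I_N -> probability (T.-tuple R) R)
    (Q : N.-tuple (T.-tuple R) -> Prop) : Prop :=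
  exists2 B : set (N.-tuple (T.-tuple R)),
    measurable B /\ (forall P, Cpl_mc mu P -> P B = 0%E) &
    forall x, ~ B x -> Q x.

Definition prices (R : realType) (T N : nat)
    (mu : 'I_N -> probability (T.-tuple R) R) (t : nat)
    (x : N.-tuple (T.-tuple R)) : N.-tuple R :=
  [tuple from0 (mu i) (@canonical_process R T) t (tnth x i) | i < N].

Definition strategies (R : realType) (T N : nat) :
    set (nat -> N.-tuple (T.-tuple R) -> N.-tuple R) :=
  [set Delta | forall t, (t < T)%N ->
     sub_measurable (info [set k | (1 <= k.2 <= t)%N]) (Delta t)].

Definition gains (R : realType) (T N : nat)
    (mu : 'I_N -> probability (T.-tuple R) R)
    (Delta : nat -> N.-tuple (T.-tuple R) -> N.-tuple R)
    (x : N.-tuple (T.-tuple R)) : R :=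
  \sum_(1 <= t < T.+1) \sum_(i < N)
    tnth (Delta t.-1 x) i *
    (tnth (prices mu t x) i - tnth (prices mu t.-1 x) i).

Definition superhedging_price (R : realType) (T N : nat)
    (mu : 'I_N -> probability (T.-tuple R) R)
    (xi : N.-tuple (T.-tuple R) -> R) : \bar R :=
  ereal_inf [set p0%:E | p0 in [set p0 : R |
    exists2 Delta, strategies Delta &
      quasi_surely mu (fun x => p0 + gains mu Delta x >= xi x)]].

(* Main.v *)
From HB Require Import structures.
Require Import Defs.
From mathcomp Require Import all_boot all_order all_algebra.
From mathcomp Require Import all_classical all_reals all_analysis.
From mathcomp Require Import measurable_realfun ring lra.

(** The theorem reduces to finite-dimensional linear programming duality.

A complete market in discrete time with one risky asset is finite: given the
past, the next price takes finitely many values only ([finitely_many_successors]).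
Indeed, replication says that every bounded function of the next increment [Y] is
affine in [Y] on the event of that past; applied to [1 / (1 + Y^2)], this confines
[Y] to the roots of a nonzero polynomial of degree at most three.
So every [mu i] has finite support ([finite_support_exists]), and every
coupling lives on the finite product [s] of these supports.

On [s] the hedging problem asks for a solution of finitely many linear
inequalities, and Farkas' lemma gives the alternative: either [p0] suffices to
superhedge [xi] at every point of [s], or there is a probability on [s] under
which all assets are martingales for the joint filtration and the mean of [xi]
exceeds [p0] ([hedge_or_coupling]).

It remains to see that the probabilities of the second kind are exactly the
multicausal couplings. A multicausal coupling makes each asset a martingale for
the joint filtration, since the past of the other assets adds no information
about its future ([multicausal_martingale_weight]); hence trading gains have mean
zero, which is weak duality. Conversely, let all assets be martingales for the
joint filtration. By completeness the indicator of a path of asset [i] is a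
constant plus a stochastic integral with respect to asset [i], so that its
conditional expectation given the joint past depends on the past of asset [i]
only and is the one under [mu i] ([conditional_future]). At time [0] this says
that the marginals are the [mu i], and at later times it is multicausality. *)

Set Implicit Arguments.
Unset Strict Implicit.
Unset Printing Implicit Defensive.

Import Order.TTheory GRing.Theory Num.Theory.
Import numFieldNormedType.Exports.

Local Open Scope classical_set_scope.
Local Open Scope ring_scope.

(** * Atoms of sigma-algebras generated by real functions *)

(** The atom through [y] of the sigma-algebra generated by the [X k], [k] in [D].
For finite [D] the atoms belong to that sigma-algebra, and each of its sets is
a union of atoms, so that conditioning reduces to computations on atoms. *)
Definition atom_of (I Om : Type) (R : realType) (D : set I)
    (X : I -> Om -> R) (y : Om) : set Om :=
  [set x | forall k, D k -> X k x = X k y].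

Section atoms.
Context (I Om : Type) (R : realType) (D : set I) (X : I -> Om -> R).

Local Notation atom := (atom_of D X).

Lemma atom_sym x y : atom y x -> atom x y.
Proof. by move=> xy k Dk; rewrite xy. Qed.

Lemma atom_eq x y : atom y x -> atom x = atom y.
Proof.
move=> xy; apply/seteqP; split => z zx k Dk; first by rewrite zx// xy.
by rewrite zx// xy.
Qed.

(** The saturated sets form a sigma-algebra that contains the preimages
generating [sigma_of D X]. *)
Lemma sigma_of_saturated A x y : sigma_of D X A -> atom y x -> A x <-> A y.
Proof.
move=> sA; have : [set B : set Om | forall x y, atom y x -> B x <-> B y] A.
  apply: (smallest_sub _ _ sA) => /=; first split => //=.
  - move=> B satB u v uv; split=> -[_ nB]; split=> //;
      by apply: contra_not nB => Bx; apply/(satB u v).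
  - move=> F satF u v uv; split => -[n _ Fn]; exists n => //.
      by apply/(satF n u v uv).
    by apply/(satF n u v uv).
  - by move=> _ [k Dk [B mB <-]] u v uv; rewrite setTI /preimage/= uv.
exact.
Qed.

Lemma sub_measurable_atom d (U : measurableType d) (f : Om -> U) :
  (forall u : U, measurable [set u]) ->
  sub_measurable (sigma_of D X) f -> forall x y, atom y x -> f x = f y.
Proof.
move=> mU mf x y /(sigma_of_saturated (mf _ (mU (f y)))) [_ fxy].
exact: fxy.
Qed.

End atoms.

(** Gives access to the closure properties of measurable functions (sums,
products, compositions) for measurability relative to a sub-sigma-algebra. *)
Lemma sub_measurableE (Om' : pointedType) d (U : measurableType d)
    (G : set_system Om') (f : Om' -> U) :
  sub_measurable <<s G >> f <->
  measurable_fun setT (f : g_sigma_algebraType G -> U).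
Proof.
split => [mf _ B mB|mf B mB]; first by rewrite setTI; exact: mf.
by rewrite -[f @^-1` B]setTI; exact: mf.
Qed.

Lemma atom_sigma_of (I : Type) (Om : pointedType) (R : realType) (D : set I)
    (X : I -> Om -> R) (y : Om) : finite_set D ->
  sigma_of D X (atom_of D X y).
Proof.
move=> fD; rewrite /sigma_of.
set G := (X in <<s X >>).
suff: measurable (atom_of D X y : set (g_sigma_algebraType G)) by [].
rewrite (_ : atom_of D X y = \bigcap_(k in D) (X k @^-1` [set X k y])) //.
apply: fin_bigcap_measurable => // k Dk.
apply: sub_sigma_algebra; exists k => //.
by exists [set X k y]; [exact: measurable_set1|rewrite setTI].
Qed.

Lemma sigma_of_measurable (I : Type) d (Om : measurableType d) (R : realType)
    (D : set I) (X : I -> Om -> R) :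
  (forall k, D k -> measurable_fun setT (X k)) ->
  sigma_of D X `<=` measurable.
Proof.
move=> mX; apply: smallest_sub; first exact: sigma_algebra_measurable.
by move=> _ [k Dk [B mB <-]]; exact: mX.
Qed.

Lemma sigma_of_sub (I Om : Type) (R : realType) (D D' : set I)
    (X : I -> Om -> R) :
  D `<=` D' -> sigma_of D X `<=` sigma_of D' X.
Proof. by move=> DD'; apply: sub_sigma_algebra2; exact: bigcup_subset. Qed.

Lemma sub_measurable_sum_indic (Om : pointedType) (R : realType)
    (G : set_system Om) (J : Type) (s : seq J) (c : J -> R) (C : J -> set Om) :
  (forall j, <<s G >> (C j)) ->
  sub_measurable <<s G >> (fun x => \sum_(j <- s) c j * \1_(C j) x).
Proof.
move=> mC; apply/sub_measurableE.
apply: measurable_sum => j.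
apply: measurable_funM => //.
by apply: measurable_indic; exact: mC.
Qed.

(** * Finitely supported probabilities *)

Definition pmass d (Om : measurableType d) (R : realType)
    (P : probability Om R) (x : Om) : R := fine (P [set x]).

Section finite_support.
Context d (Om : measurableType d) (R : realType) (P : probability Om R).
Context (s : seq Om).
Hypothesis mset1 : forall x : Om, measurable [set x].
Hypothesis uniq_s : uniq s.
Hypothesis supp_s : P (~` [set` s]) = 0%E.

Local Notation w := (pmass P).

Lemma pmass_ge0 x : 0 <= w x.
Proof. exact: fine_ge0. Qed.

Lemma pmassE x : (w x)%:E = P [set x].
Proof. by rewrite fineK// fin_num_measure. Qed.

(** A null set contains no point of positive mass: this is how almost sure
identities become pointwise ones on a finite support. *)
Lemma ae_pmass_gt0 (Q : Om -> Prop) x :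
  {ae P, forall x, Q x} -> 0 < w x -> Q x.
Proof.
move=> [N [mN N0 QN]] wx; apply: contrapT => Qx; move: wx.
have xN : [set x] `<=` N by move=> _ ->; exact: QN.
suff -> : w x = 0 by rewrite ltxx.
by rewrite /pmass (subset_measure0 _ _ xN).
Qed.

Lemma measurable_seq (r : seq Om) : measurable [set` r].
Proof.
elim: r => [|x r ihr].
  by rewrite (_ : [set` _] = set0)// -subset0 => x /=; rewrite inE.
rewrite (_ : [set` _] = [set x] `|` [set` r]); first exact: measurableU.
apply/seteqP; split => y /=; rewrite inE; first by case/predU1P; [left|right].
by move=> /predU1P.
Qed.

Lemma sum_indic_seq (f : Om -> R) x : x \in s ->
  \sum_(y <- s) f y * \1_[set y] x = f x.
Proof.
move=> xs; rewrite (bigD1_seq x)//= indicE mem_set//= mulr1 big1 ?addr0// => y yx.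
by rewrite indicE memNset ?mulr0//= => xy; rewrite xy eqxx in yx.
Qed.

(** [f] agrees almost everywhere with the step function
[sum_(y <- s) f y * 1_{y}], whose integral is computed termwise. *)
Lemma integral_finite_support A (f : Om -> R) :
  measurable A -> measurable_fun setT f ->
  (\int[P]_(x in A) (f x)%:E = (\sum_(x <- s) w x * \1_A x * f x)%:E)%E.
Proof.
move=> mA mf.
pose g x := \sum_(y <- s) (f y * \1_[set y] x).
have mg1 y : measurable_fun setT (fun x : Om => f y * \1_[set y] x).
  by apply: measurable_funM => //; exact: measurable_indic.
rewrite (@ae_eq_integral _ _ _ P A (EFin \o g)) //.
- under eq_integral do rewrite /= -sumEFin.
  rewrite integral_sum//.
    rewrite -sumEFin; apply: eq_bigr => y _.
    under eq_integral do rewrite EFinM.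
    rewrite integralZl//; last first.
      apply: (@integrableS _ _ _ _ setT) => //.
      exact: integrable_indic.
    rewrite integral_indic// mulrC EFinM; congr (_ * _)%E.
    have [yA|yA] := boolP (y \in A); rewrite indicE.
      rewrite yA mulr1 pmassE; congr (P _).
      apply/seteqP; split => z /=; first by case.
      by move=> ->; split => //; exact/set_mem.
    rewrite (negbTE yA) mulr0 (_ : _ `&` _ = set0) ?measure0//.
    by rewrite -subset0 => z /= [->] /mem_set; exact/negP.
  move=> y; apply: (@integrableS _ _ _ _ setT) => //.
  under [X in integrable _ _ X]eq_fun do rewrite EFinM.
  apply: integrableZl => //; exact: integrable_indic.
- by apply/measurable_EFinP; exact: measurable_funTS.
- apply/measurable_EFinP; apply: measurable_funTS.
  by apply: measurable_sum => y.
- exists (~` [set` s]); split => //.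
    by apply: measurableC; exact: measurable_seq.
  move=> x /= fg xs; apply: fg => _; congr EFin.
  by rewrite /g sum_indic_seq.
Qed.

Lemma integrable_finite_support (f : Om -> R) : measurable_fun setT f ->
  P.-integrable setT (EFin \o f).
Proof.
move=> mf; apply/integrableP; split; first exact/measurable_EFinP.
rewrite (eq_integral (fun x => (`|f x|)%:E)) // integral_finite_support ?ltry//.
exact: measurableT_comp.
Qed.

Lemma measure_finite_support A : measurable A ->
  (P A = (\sum_(x <- s) w x * \1_A x)%:E)%E.
Proof.
move=> mA; rewrite -[LHS]mul1e -integral_cst//.
rewrite (integral_finite_support mA (measurable_cst (1 : R))).
by congr EFin; apply: eq_bigr => x _; rewrite mulr1.
Qed.

End finite_support.

(** * Farkas' lemma and roots of polynomials *)

Lemma exists_between (R : realFieldType) (I : finType) (P N : pred I)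
    (f g : I -> R) :
  (forall k l, P k -> N l -> f k <= g l) ->
  exists z, (forall k, P k -> f k <= z) /\ (forall l, N l -> z <= g l).
Proof.
move=> fg; have [/existsP[k0 Pk0]|/existsPn P0] := boolP [exists k, P k].
  case: (@Order.TotalTheory.arg_maxP _ _ _ k0 P f Pk0) => k Pk maxk.
  exists (f k); split; first exact: maxk.
  by move=> l; exact: fg.
have [/existsP[l0 Nl0]|/existsPn N0] := boolP [exists l, N l].
  case: (@Order.TotalTheory.arg_minP _ _ _ l0 N g Nl0) => l Nl minl.
  exists (g l); split=> // k Pk.
  by have := P0 k; rewrite Pk.
by exists 0; split=> k; [have := P0 k|have := N0 k] => /negbTE ->.
Qed.

(** Fourier-Motzkin elimination of the first variable. From the constraints
[b i <= a i . v] one forms nonnegative combinations [c k] in which that variable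
has coefficient [0]: single constraints not involving it, and the combination
of each constraint bounding it from below with each one bounding it from above.
A solution of the new system leaves a nonempty interval for the first variable,
and a certificate of infeasibility of the new system pulls back along [c]. *)
Lemma farkas_ord (R : realFieldType) (n : nat) (I : finType)
    (a : I -> 'I_n -> R) (b : I -> R) :
  (exists v : 'I_n -> R, forall i, b i <= \sum_j a i j * v j) \/
  (exists q : I -> R, [/\ forall i, 0 <= q i,
     forall j, \sum_i q i * a i j = 0 & 0 < \sum_i q i * b i]).
Proof.
elim: n => [|n ihn] in I a b *.
  have [/forallP b0|] := boolP [forall i, b i <= 0].
    (* Without variables the system reads b i <= 0. *)
    by left; exists (fun=> 0) => i; rewrite big_ord0.
  rewrite negb_forall => /existsP[i]; rewrite -ltNge => bi.
  right; exists (fun k => (k == i)%:R); split=> //.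
  - by move=> j; case: j.
  - rewrite (bigD1 i)//= eqxx mul1r big1 ?addr0// => k /negbTE ->.
    by rewrite mul0r.
pose p i := a i ord0.
(* Index pairs that eliminate nothing get the trivial constraint 0 <= 0. *)
pose c (k : I + I * I) i : R := match k with
  | inl k => ((p k == 0%R) && (i == k))%:R
  | inr (k, l) => if (0 < p k) && (p l < 0)
                  then (i == k)%:R * (- p l) + (i == l)%:R * p k else 0
  end.
have sum1 k (h : I -> R) : \sum_i (i == k)%:R * h i = h k.
  rewrite (bigD1 k)//= eqxx mul1r big1 ?addr0// => i /negbTE ->.
  by rewrite mul0r.
have sumcl k h : \sum_i c (inl k) i * h i = (p k == 0)%:R * h k.
  rewrite /c; case: eqP => _ /=; first by rewrite sum1 mul1r.
  by rewrite mul0r big1// => i _; rewrite mul0r.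
have sumcr k l h : \sum_i c (inr (k, l)) i * h i =
    if (0 < p k) && (p l < 0) then - p l * h k + p k * h l else 0.
  rewrite /c; case: ifP => _; last by rewrite big1// => i _; rewrite mul0r.
  under eq_bigr do rewrite mulrDl -!mulrA.
  by rewrite big_split/= !sum1.
have c0 k i : 0 <= c k i.
  case: k => [k|[k l]] /=; first by rewrite ler0n.
  case: ifP => // /andP[pk pl].
  by rewrite addr_ge0// mulr_ge0 ?ler0n// ?oppr_ge0 ltW.
have cp k : \sum_i c k i * p i = 0.
  case: k => [k|[k l]].
    by rewrite sumcl; case: eqP => [->|]; rewrite ?mulr0 ?mul0r.
  by rewrite sumcr; case: ifP => // _; rewrite mulNr mulrC addNr.
have exch (q : I + I * I -> R) (h : I -> R) :
    \sum_i (\sum_k q k * c k i) * h i = \sum_k q k * \sum_i c k i * h i.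
  under eq_bigr do rewrite mulr_suml.
  rewrite exchange_big/=; apply: eq_bigr => k _; rewrite mulr_sumr.
  by apply: eq_bigr => i _; rewrite mulrA.
have [[v hv]|[q [q0 qa qb]]] := ihn (I + I * I)%type
    (fun k j => \sum_i c k i * a i (lift ord0 j)) (fun k => \sum_i c k i * b i).
- left; pose r i := b i - \sum_j a i (lift ord0 j) * v j.
  have cr k : \sum_i c k i * r i <= 0.
    have := hv k; under [X in _ <= X]eq_bigr do rewrite mulr_suml.
    rewrite exchange_big/= -subr_le0 -sumrB; congr (_ <= _).
    apply: eq_bigr => i _; rewrite mulrBr mulr_sumr; congr (_ - _).
    by apply: eq_bigr => j _; rewrite mulrA.
  have [|z [zl zu]] := @exists_between _ I (fun k => 0 < p k) (fun l => p l < 0)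
      (fun k => r k / p k) (fun l => r l / p l).
    move=> k l pk pl; have := cr (inr (k, l)); rewrite sumcr pk pl/=.
    rewrite ler_pdivrMr// mulrAC ler_ndivlMr// => h.
    by rewrite -subr_ge0; move: h; rewrite -oppr_ge0; congr (_ <= _); ring.
  exists (fun j => oapp v z (unlift ord0 j)) => i.
  rewrite big_ord_recl unlift_none/= -/(p i).
  under eq_bigr do rewrite liftK/=.
  rewrite -lerBlDr -/(r i).
  have [pi|pi|pi] := ltgtP (p i) 0.
  + by rewrite mulrC -ler_ndivlMr// zu.
  + by rewrite mulrC -ler_pdivrMr// zl.
  + have := cr (inl i); rewrite sumcl pi eqxx mul1r.
    by rewrite mul0r.
- right; exists (fun i => \sum_k q k * c k i); split.
  + by move=> i; apply: sumr_ge0 => k _; rewrite mulr_ge0.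
  + move=> j; rewrite exch; have [j' ->|->] := unliftP ord0 j.
      by rewrite -[RHS](qa j').
    by rewrite big1// => k _; rewrite cp mulr0.
  + by rewrite exch.
Qed.

Lemma farkas (R : realFieldType) (I J : finType)
    (a : I -> J -> R) (b : I -> R) :
  (exists v : J -> R, forall i, b i <= \sum_j a i j * v j) \/
  (exists q : I -> R, [/\ forall i, 0 <= q i,
     forall j, \sum_i q i * a i j = 0 & 0 < \sum_i q i * b i]).
Proof.
have [[v hv]|[q [q0 qa qb]]] :=
  @farkas_ord R #|J| I (fun i k => a i (enum_val k)) b.
  left; exists (fun j => v (enum_rank j)) => i; rewrite (reindex (@enum_val J J))/=.
    by under eq_bigr do rewrite enum_valK.
  exact/onW_bij/enum_val_bij.
right; exists q; split=> // j.
by rewrite -[RHS](qa (enum_rank j)) enum_rankK.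
Qed.

Lemma finite_roots (R : idomainType) (p : {poly R}) : p != 0 ->
  exists l : seq R, forall x, root p x -> x \in l.
Proof.
have [n] := ubnP (size p); elim: n p => // n ihn p; rewrite ltnS => np p0.
have [[x /factor_theorem[q pq]]|noroot] := pselect (exists x, root p x); last first.
  by exists [::] => x px; case: noroot; exists x.
have q0 : q != 0 by apply: contra_neq p0 => q0; rewrite pq q0 mul0r.
have [|//|l hl] := ihn q.
  rewrite (leq_trans _ np)// pq size_Mmonic ?monicXsubC// size_XsubC addnC.
  by rewrite ltnS.
exists (x :: l) => y; rewrite pq rootM root_XsubC inE => /orP[/hl ->|->//].
by rewrite orbT.
Qed.

(** * Conditional expectations on a finite support *)

Lemma sum_indic_atom_const (Om : pointedType) (I : Type) (R : realType)
    (D : set I) (X : I -> Om -> R) (g : Om -> R) (y x : Om) :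
  (forall x y, atom_of D X y x -> g x = g y) ->
  \1_(atom_of D X y) x * g x = \1_(atom_of D X y) x * g y.
Proof.
move=> gC; rewrite indicE; have [/set_mem/gC ->//|_] := boolP (x \in _).
by rewrite !mul0r.
Qed.

(** A sum that vanishes over each atom vanishes against every function constant
on atoms. Spreading the term at [x] uniformly over the [n x] points of its atom
and exchanging the two sums avoids choosing representatives of the atoms. *)
Lemma sum_atoms_eq0 (Om : pointedType) (I : Type) (R : realType)
    (D : set I) (X : I -> Om -> R) (s : seq Om) (h g : Om -> R) :
  (forall y, y \in s -> \sum_(x <- s) h x * \1_(atom_of D X y) x = 0) ->
  (forall x y, atom_of D X y x -> g x = g y) ->
  \sum_(x <- s) h x * g x = 0.
Proof.
move=> h0 gC; pose n y : R := \sum_(x <- s) \1_(atom_of D X y) x.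
have n_neq0 y : y \in s -> n y != 0.
  move=> ys; rewrite gt_eqF// /n (big_rem y)//= ltr_pwDl//.
    by rewrite indicE mem_set.
  by apply: sumr_ge0 => x _; rewrite indicE.
have sym x y : \1_(atom_of D X y) x / n y = \1_(atom_of D X x) y / n x.
  rewrite !indicE; have [/set_mem xy|xy] := boolP (x \in _).
    rewrite mem_set; last exact: atom_sym.
    by rewrite /n (atom_eq xy).
  rewrite memNset ?mul0r// => yx.
  by move/negP: xy; apply; apply: mem_set; exact: atom_sym.
transitivity (\sum_(x <- s) \sum_(y <- s)
    g y / n y * (h x * \1_(atom_of D X y) x)).
  rewrite big_seq [RHS]big_seq; apply: eq_bigr => x xs.
  transitivity (\sum_(y <- s) h x * g x * (\1_(atom_of D X y) x / n y)).
    under eq_bigr do rewrite sym.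
    by rewrite -mulr_sumr -mulr_suml divff ?mulr1// n_neq0.
  apply: eq_bigr => y _; transitivity (h x / n y * (\1_(atom_of D X y) x * g x)).
    by ring.
  by rewrite (sum_indic_atom_const _ _ gC); ring.
rewrite exchange_big big_seq big1//= => y ys.
by rewrite -mulr_sumr h0// mulr0.
Qed.

Section finite_condexp.
Context d (Om : measurableType d) (R : realType) (P : probability Om R).
Context (s : seq Om).
Hypothesis mset1 : forall x : Om, measurable [set x].
Hypothesis uniq_s : uniq s.
Hypothesis supp_s : P (~` [set` s]) = 0%E.
Context (I : Type) (D : set I) (X : I -> Om -> R).
Hypothesis finD : finite_set D.
Hypothesis mX : forall k, D k -> measurable_fun setT (X k).

Local Notation w := (pmass P).
Local Notation G := (sigma_of D X).
Local Notation atom := (atom_of D X).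

Lemma sub_measurableW d' (U : measurableType d') (f : Om -> U) :
  sub_measurable G f -> measurable_fun setT f.
Proof.
by move=> mf _ B mB; rewrite setTI; apply: (sigma_of_measurable mX); exact: mf.
Qed.

Lemma indic_sigma_of_atom A x y : G A -> atom y x -> \1_A x = \1_A y :> R.
Proof.
move=> GA /(sigma_of_saturated GA) xy; rewrite !indicE; congr (nat_of_bool _)%:R.
by apply/idP/idP => /set_mem /xy /mem_set.
Qed.

(** On a finite support all integrals are finite sums, and the indicator of a
set of [sigma_of D X] is constant on atoms. *)
Lemma is_condexpP f g : measurable_fun setT f -> sub_measurable G g ->
  (forall h : Om -> R, (forall x y, atom y x -> h x = h y) ->
    \sum_(x <- s) w x * h x * g x = \sum_(x <- s) w x * h x * f x) ->
  is_condexp P G f g.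
Proof.
move=> mf mg fg; have mg' := sub_measurableW mg.
split=> //; first exact: integrable_finite_support mset1 uniq_s supp_s _ mg'.
move=> A GA; have mA := sigma_of_measurable mX GA.
rewrite !(integral_finite_support mset1 uniq_s supp_s)//.
congr EFin; apply: fg => x y xy; exact: indic_sigma_of_atom.
Qed.

Lemma is_condexp_sum f g A : is_condexp P G f g -> measurable_fun setT f -> G A ->
  \sum_(x <- s) w x * \1_A x * g x = \sum_(x <- s) w x * \1_A x * f x.
Proof.
move=> [mg _ fg] mf GA; have mA := sigma_of_measurable mX GA.
have mg' := sub_measurableW mg.
have := fg A GA; rewrite !(integral_finite_support mset1 uniq_s supp_s)//.
by case.
Qed.

(** A conditional expectation is constant on an atom, where it is the average
of [f]; multiplying by the mass of the atom also covers null atoms. *)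
Lemma is_condexp_atom f g y : is_condexp P G f g -> measurable_fun setT f ->
  g y * (\sum_(x <- s) w x * \1_(atom y) x) =
  \sum_(x <- s) w x * \1_(atom y) x * f x.
Proof.
move=> fg mf; rewrite -(is_condexp_sum fg mf (atom_sigma_of y finD)).
rewrite mulr_sumr; apply: eq_bigr => x _.
have [mg _ _] := fg; rewrite -mulrA (sum_indic_atom_const (g := g)); first by ring.
by apply: sub_measurable_atom mg => u; exact: measurable_set1.
Qed.

(** The average of [f] over each atom; on a null atom the division by [0]
returns [0], which is harmless because the points of [s] in it carry no mass. *)
Lemma finite_condexp_exists f : exists2 g, sub_measurable G g &
  forall h : Om -> R, (forall x y, atom y x -> h x = h y) ->
    \sum_(x <- s) w x * h x * g x = \sum_(x <- s) w x * h x * f x.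
Proof.
pose n y := \sum_(x <- s) w x * \1_(atom y) x.
exists (fun x => \sum_(y <- s) (w y * f y / n y) * \1_(atom y) x).
  by apply: sub_measurable_sum_indic => y; exact: atom_sigma_of.
move=> h hC; under eq_bigr do rewrite mulr_sumr.
rewrite exchange_big/= big_seq [RHS]big_seq; apply: eq_bigr => y ys.
transitivity (w y * f y / n y * h y * n y).
  rewrite /n mulr_sumr; apply: eq_bigr => x _.
  transitivity (w y * f y / n y * w x * (\1_(atom y) x * h x)); first by ring.
  by rewrite (sum_indic_atom_const _ _ hC); ring.
have [n0|n0] := eqVneq (n y) 0; last by field.
have -> : w y = 0; last by rewrite !mul0r.
apply: le_anti; rewrite pmass_ge0 andbT -n0 /n (big_rem y)//= indicE mem_set//.
rewrite mulr1 lerDl; apply: sumr_ge0 => x _.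
by rewrite mulr_ge0// ?pmass_ge0// indicE.
Qed.

End finite_condexp.

(** * Complete markets have finite support *)

Lemma measurable_tuple_set1 d (U : measurableType d) n (x : n.-tuple U) :
  (forall u : U, measurable [set u]) -> measurable [set x].
Proof.
move=> mU; rewrite (_ : [set x] = \bigcap_(i in [set: 'I_n])
    ((@tnth n U ^~ i) @^-1` [set tnth x i])).
  apply: fin_bigcap_measurable => // i _; rewrite -[X in measurable X]setTI.
  exact: measurable_tnth.
apply/seteqP; split => [_ ->//|y xy] /=.
by apply: eq_from_tnth => i; exact: xy.
Qed.

Lemma measurable_path_set1 (R : realType) T (x : T.-tuple R) :
  measurable [set x].
Proof. by apply: measurable_tuple_set1 => u; exact: measurable_set1. Qed.

Lemma finite_setn (P : set nat) t : P `<=` [set s | (s <= t)%N] -> finite_set P.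
Proof. by move=> Pt; exact: (sub_finite_set Pt (finite_II t.+1)). Qed.

Section path_atoms.
Context (R : realType) (T : nat).
Local Notation X := (@canonical_process R T).

Definition upto (t : nat) : set nat := [set s | (1 <= s <= t)%N].

Definition path_atom t (y : T.-tuple R) := atom_of (upto t) X y.

Lemma finite_upto t : finite_set (upto t).
Proof. by apply: (@finite_setn _ t) => s /= /andP[]. Qed.

Lemma measurable_canonical_process t : measurable_fun setT (X t).
Proof.
have [tT|tT] := ltnP t.-1 T.
  rewrite (_ : X t = (@tnth T R ^~ (Ordinal tT))); first exact: measurable_tnth.
  by apply/funext => x; rewrite (tnth_nth 0).
rewrite (_ : X t = cst 0); first exact: measurable_cst.
by apply/funext => x; rewrite /canonical_process nth_default// size_tuple.
Qed.

Lemma sub_upto s t : (s <= t)%N -> upto s `<=` upto t.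
Proof.
by move=> st r /andP[r0 rs]; apply/andP; split=> //; exact: leq_trans st.
Qed.

Lemma path_atom_total y x : path_atom T y x -> x = y.
Proof.
move=> xy; apply: eq_from_tnth => i; rewrite !(tnth_nth 0).
by apply: (xy i.+1); rewrite /upto/= ltn_ord.
Qed.

Lemma path_atomS t y x : path_atom t.+1 y x <->
  path_atom t y x /\ X t.+1 x = X t.+1 y.
Proof.
split=> [xy|[xy e]]; first split.
- by move=> s /(sub_upto (leqnSn t)); exact: xy.
- by apply: xy; rewrite /upto/= ltnSn.
- move=> s; rewrite /upto/= => /andP[s0]; rewrite leq_eqVlt => /predU1P[->//|st].
  by apply: xy; rewrite /upto/= s0.
Qed.

Lemma from0_path_atom (mu : probability (T.-tuple R) R) t y x :
  path_atom t y x -> from0 mu X t x = from0 mu X t y.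
Proof. by case: t => // t xy; apply: xy; rewrite /upto/= ltnSn. Qed.

End path_atoms.

(** A set of the sigma-algebra contains the atom or is disjoint from it. Hence
a function living on one atom and of mean zero has conditional expectation zero. *)
Lemma integral_supported_on_atom d (Om : measurableType d) (R : realType)
    (P : probability Om R) (I : Type) (D : set I) (X : I -> Om -> R) (y : Om)
    (M : Om -> R) (A : set Om) :
  P.-integrable setT (EFin \o M) ->
  (forall x, ~ atom_of D X y x -> M x = 0) -> sigma_of D X A ->
  (\int[P]_(x in A) (M x)%:E = (\1_A y)%:E * \int[P]_x (M x)%:E)%E.
Proof.
move=> iM M0 sA; rewrite [LHS]integral_mkcond -integralZl//.
apply: eq_integral => x _ /=; rewrite epatch_indic muleC -EFinM; congr EFin.
have [xy|xy] := pselect (atom_of D X y x); last by rewrite M0// !mulr0.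
by rewrite (indic_sigma_of_atom sA xy).
Qed.

(** Clearing denominators gives a polynomial of degree at most three, and the
constant and quadratic coefficients, [1 - c] and [- c], do not both vanish. The
bump [1 / (1 + u^2)] serves because it is bounded and meets every line in
finitely many points only. *)
Lemma finite_bump_line (R : realFieldType) (c d : R) :
  exists l : seq R, forall u, (1 + u ^+ 2)^-1 - c = d * u -> u \in l.
Proof.
pose p : {poly R} := (1 - c)%:P - d *: 'X - c *: 'X^2 - d *: 'X^3.
have pE u : p.[u] = 1 - c - d * u - c * u ^+ 2 - d * u ^+ 3.
  by rewrite /p !hornerE.
have p0 : p != 0.
  apply/eqP => p0.
  have := pE 0; have := pE 1; have := pE (-1); rewrite p0 !horner0.
  by clear; lra.
have [l pl] := finite_roots p0.
exists l => u cd; apply: pl; rewrite /root pE.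
have u0 : 1 + u ^+ 2 != 0 by rewrite gt_eqF// ltr_pwDl// sqr_ge0.
have : (1 + u ^+ 2) * ((1 + u ^+ 2)^-1 - c) = (1 + u ^+ 2) * (d * u) by rewrite cd.
rewrite mulrBr divff// => e; apply/eqP; move: e; clear; lra.
Qed.

Lemma ae_all_seq d (Om : measurableType d) (R : realType)
    (mu : probability Om R) (J : choiceType) (s : seq J) (Q : J -> Om -> Prop) :
  (forall y, {ae mu, forall x, Q y x}) ->
  {ae mu, forall x, forall y, y \in s -> Q y x}.
Proof.
move=> Qy; elim: s => [|y s ihs]; first exact/nearW.
apply: filterS2 (Qy y) ihs => x Qyx Qsx z; rewrite inE => /predU1P[->//|].
exact: Qsx.
Qed.

Section complete_implies_finite.
Context (R : realType) (T : nat) (mu : probability (T.-tuple R) R).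
Hypothesis mu_complete : complete_market mu.

Local Notation X := (@canonical_process R T).
Local Notation X0 := (from0 mu X).
Local Notation F := (@canonical_filtration R T).

(** A replicable claim is affine in the next price, given the past, which leaves
room for finitely many next prices only. Let [C] be the event that the path
agrees with [y] up to time [t], and [Y] the next price increment on [C]. The
process equal to [0] up to time [t] and to [1_C * (1 / (1 + Y^2) - c)]
afterwards is a martingale, for [c] the conditional mean of the bump on [C]. Being replicable, it satisfies
[1 / (1 + Y^2) - c = d * Y] on [C], with [d] the value on [C] of the hedging
position, and this equation has finitely many solutions. *)
Lemma finitely_many_successors t (y : T.-tuple R) : (t < T)%N ->
  exists l : seq R, {ae mu, forall x, path_atom t y x -> X t.+1 x \in l}.
Proof.
move=> tT; set C := path_atom t y.
have FC : F t C by apply: atom_sigma_of; exact: finite_upto.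
have mC : measurable C.
  by apply: sigma_of_measurable FC => s _; exact: measurable_canonical_process.
have [muC0|muC0] := eqVneq (mu C) 0%E.
  exists [::]; exists C; split => // x /=.
  by apply: contra_notP => Cx.
pose a := X0 t y.
pose k (u : R) := (1 + (u - a) ^+ 2)^-1.
have k1 u : 1 <= 1 + (u - a) ^+ 2 by rewrite lerDl sqr_ge0.
have mk : measurable_fun setT k.
  apply: continuous_measurable_fun => u; apply: cvgV.
    by rewrite gt_eqF// (lt_le_trans ltr01).
  apply: cvgD; first exact: cvg_cst.
  apply: cvgM; (apply: cvgB; [exact: cvg_id|exact: cvg_cst]).
pose m c x := \1_C x * (k (X t.+1 x) - c).
have Fm c s : (t < s)%N -> sub_measurable (F s) (m c).
  move=> ts; apply/sub_measurableE; apply: measurable_funM.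
    apply: measurable_indic; apply: (sigma_of_sub _ FC).
    by apply: sub_upto; exact: ltnW.
  apply: measurable_funB; last exact: measurable_cst.
  apply: measurableT_comp => //; apply/sub_measurableE => B mB.
  apply: sub_sigma_algebra; exists t.+1; first by rewrite /= ts.
  by exists B => //; rewrite setTI.
have mm c : measurable_fun setT (m c).
  apply: (sub_measurableW _ (Fm c _ (ltnSn t))) => s _.
  exact: measurable_canonical_process.
have im c : mu.-integrable setT (EFin \o m c).
  apply: (@le_integrable _ _ _ mu setT measurableT _ (EFin \o cst (1 + `|c|))).
  - exact/measurable_EFinP.
  - move=> x _; rewrite /= lee_fin /m normrM [leRHS]ger0_norm; last first.
      by rewrite addr_ge0.
    rewrite -[leRHS]mul1r ler_pM//.
      by rewrite ger0_norm ?indicE// lern1 leq_b1.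
    rewrite (le_trans (ler_normB _ _))// lerD2r ger0_norm.
      by rewrite invf_le1 ?(lt_le_trans ltr01).
    by rewrite invr_ge0 (le_trans ler01).
  - exact: finite_measure_integrable_cst.
have fC : mu C \is a fin_num by exact: fin_num_measure.
have fm0 : (\int[mu]_x (m 0 x)%:E)%E \is a fin_num.
  exact: integrable_fin_num (im 0).
pose c := fine (\int[mu]_x (m 0 x)%:E)%E / fine (mu C).
have intm : (\int[mu]_x (m c x)%:E = 0)%E.
  under eq_integral => x _.
    have -> : (m c x)%:E = ((m 0 x)%:E - c%:E * (\1_C x)%:E)%E.
      by rewrite -EFinM -EFinB; congr EFin; rewrite /m; ring.
    over.
  rewrite integralB//; first last.
  - by apply: integrableZl => //; exact: integrable_indic.
  - exact: im.
  rewrite integralZl//; last exact: integrable_indic.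
  rewrite integral_indic// setIT -[X in (_ * X)%E]fineK// -EFinM /c.
  by rewrite divfK ?fine_eq0// fineK// subee.
pose M s := if (s <= t)%N then cst 0 else m c.
have intM s : (\int[mu]_x (M s x)%:E = 0)%E.
  by rewrite /M; case: ifP => _ //; exact: integral0.
have martM : is_martingale mu F T M.
  have FM s : sub_measurable (F s) (M s).
    rewrite /M; have [st|ts] := leqP s t; last exact: Fm.
    by apply/sub_measurableE; exact: measurable_cst.
  have iM s : mu.-integrable setT (EFin \o M s).
    rewrite /M; case: ifP => _; last exact: im.
    exact: finite_measure_integrable_cst.
  split=> [s _|s s' /andP[_ ss'] _]; first by split.
  split=> // A FA; rewrite /M.
  have [st|ts] := leqP s t; have [s't|ts'] := leqP s' t => //; last first.
    by move: (leq_trans ts ss'); rewrite ltnNge s't.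
  rewrite [RHS](@integral_supported_on_atom _ _ _ _ _ (upto t) X y)//.
  - by rewrite intm mule0 integral0.
  - by move=> x Cx; rewrite /m indicE memNset ?mul0r.
  - apply: sigma_of_sub FA; exact: sub_upto.
have [Delta [FDelta repM]] := mu_complete martM.
have E0 : fine ('E_mu[M 1%N])%E = 0 by rewrite unlock intM.
pose d := Delta t y.
(* Subtracting the representations at times t and t + 1 leaves the single
   increment d * Y on the atom C. *)
have [l hl] := finite_bump_line c d.
exists [seq u + a | u <- l].
apply: filterS2 (repM t.+1 tT) (repM t (ltnW tT)) => x.
rewrite big_nat_recr//= => + + Cx.
have -> : from0 mu M t x = 0.
  by rewrite /from0; case Et : {1}t => [|n]; rewrite ?E0// /M Et leqnn.
rewrite E0 !add0r => + /esym sum0; rewrite sum0 add0r /M ltnn /m indicE mem_set// mul1r.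
rewrite (sub_measurable_atom _ (FDelta t tT) Cx) ?(from0_path_atom _ Cx) => [Dx|u].
  apply/mapP; exists (X t.+1 x - a); last by rewrite subrK.
  exact: hl.
exact: measurable_set1.
Qed.

(** Atoms are listed by representatives; those at time [t + 1] are obtained by
overwriting the entry of index [t] (the price at time [t + 1]) with each of the
finitely many possible values. *)
Lemma finitely_many_path_atoms t : (t <= T)%N -> exists s : seq (T.-tuple R),
  {ae mu, forall x, exists2 y, y \in s & path_atom t y x}.
Proof.
elim: t => [_|t iht tT].
  exists [:: point]; apply: nearW => x; exists point; first by rewrite inE.
  by move=> s /=; rewrite /upto/=; case: s.
have [s hs] := iht (ltnW tT).
have [l hl] := choice (fun y => finitely_many_successors y tT).
pose upd (y : T.-tuple R) r : T.-tuple R :=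
  [tuple if i == t :> nat then r else tnth y i | i < T].
have updE y r n : (0 < n <= T)%N -> X n (upd y r) = if n.-1 == t then r else X n y.
  case: n => // n /andP[_ nT].
  have XE z : X n.+1 z = tnth z (Ordinal nT) by rewrite (tnth_nth 0).
  by rewrite !XE tnth_mktuple.
exists [seq upd y r | y <- s, r <- l y].
apply: filterS2 hs (ae_all_seq s hl) => x [y ys xy] /(_ y ys xy) xl.
exists (upd y (X t.+1 x)); first by apply/allpairsPdep; exists y, (X t.+1 x).
apply/path_atomS; split.
  move=> n nt; have /andP[n0 nt'] := nt.
  rewrite updE ?n0 ?(leq_trans nt' (ltnW tT))// ltn_eqF//; first exact: xy.
  by case: n n0 nt' {nt}.
by rewrite updE/= ?eqxx.
Qed.

(** Points of zero mass are dropped so that almost sure identities hold at every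
point of the list. *)
Lemma finite_support_exists : exists s : seq (T.-tuple R),
  [/\ uniq s, forall x, x \in s -> 0 < pmass mu x & mu (~` [set` s]) = 0%E].
Proof.
have mset1 := @measurable_path_set1 R T.
have [s hs] := finitely_many_path_atoms (leqnn T).
exists [seq x <- undup s | 0 < pmass mu x]; split.
- by rewrite filter_uniq// undup_uniq.
- by move=> x; rewrite mem_filter => /andP[].
have null (y : T.-tuple R) : {ae mu, forall x, pmass mu y = 0 -> x <> y}.
  have [y0|y0] := eqVneq (pmass mu y) 0; last first.
    by apply: nearW => x /eqP; rewrite (negPf y0).
  exists [set y]; split=> //; first by rewrite -pmassE// y0.
  by move=> x /=; apply: contra_notP => + _.
apply/negligibleP; first by apply: measurableC; exact: measurable_seq.
apply: filterS2 hs (ae_all_seq s null) => x [y ys /path_atom_total ->].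
move=> /(_ y ys) y0; rewrite /= mem_filter mem_undup ys andbT.
by rewrite lt_neqAle pmass_ge0 andbT eq_sym; apply/eqP => /y0; exact.
Qed.

End complete_implies_finite.

(** * Replication of indicators in one market *)

Lemma sum_pmass1 d (Om : measurableType d) (R : realType)
    (P : probability Om R) (s : seq Om) :
  (forall x : Om, measurable [set x]) -> uniq s -> P (~` [set` s]) = 0%E ->
  \sum_(x <- s) pmass P x = 1.
Proof.
move=> m1 us ss; have := measure_finite_support m1 us ss measurableT.
rewrite probability_setT; under eq_bigr do rewrite indicT mulr1.
by case.
Qed.

Section finite_complete_market.
Context (R : realType) (T : nat) (mu : probability (T.-tuple R) R).
Context (s : seq (T.-tuple R)).
Hypothesis uniq_s : uniq s.
Hypothesis pos_s : forall x, x \in s -> 0 < pmass mu x.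
Hypothesis supp_s : mu (~` [set` s]) = 0%E.

Local Notation X := (@canonical_process R T).
Local Notation X0 := (from0 mu X).
Local Notation F := (@canonical_filtration R T).
Local Notation w := (pmass mu).
Let mset1 := @measurable_path_set1 R T.

Lemma expectation_finite_support (f : T.-tuple R -> R) :
  measurable_fun setT f -> 'E_mu[f]%E = (\sum_(x <- s) w x * f x)%:E.
Proof.
move=> mf; rewrite unlock (integral_finite_support mset1 uniq_s supp_s)//.
by under eq_bigr do rewrite indicT mulr1.
Qed.

Lemma finite_martingale t y : is_martingale mu F T X -> (t < T)%N ->
  \sum_(x <- s) w x * \1_(path_atom t y) x * (X0 t.+1 x - X0 t x) = 0.
Proof.
move=> [_ martX] tT; under eq_bigr do rewrite mulrBr.
rewrite sumrB; apply/eqP; rewrite subr_eq0; apply/eqP.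
case: t tT => [|t] tT.
  have e x : w x * \1_(path_atom 0 y) x = w x.
    by rewrite indicE mem_set ?mulr1//; case=> // n /andP[].
  under eq_bigr do rewrite e; under [RHS]eq_bigr do rewrite e.
  rewrite /= -mulr_suml sum_pmass1// mul1r expectation_finite_support//.
  exact: measurable_canonical_process.
apply/esym; apply: (is_condexp_sum mset1 uniq_s supp_s (D := upto t.+1) (X := X)).
- by move=> k _; exact: measurable_canonical_process.
- by apply: martX => //=.
- exact: measurable_canonical_process.
- by apply: atom_sigma_of; exact: finite_upto.
Qed.

(** The claim paying [1] on the path [z] has the price process
[mu {z} / mu (path_atom t z) * 1_(path_atom t z)], a martingale; completeness
writes it as a stochastic integral. Since the listed paths have positive mass,
the identity holds at each of them. The coefficient [kappa t] is the conditional
probability of [z] given its past up to time [t]. *)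
Lemma indicator_replication z : complete_market mu -> z \in s ->
  exists (Delta : nat -> T.-tuple R -> R) (kappa : nat -> R), [/\
    forall t, (t < T)%N -> sub_measurable (F t) (Delta t),
    kappa 0%N = w z, kappa T = 1 &
    forall t x, (t <= T)%N -> x \in s ->
      kappa t * \1_(path_atom t z) x =
      w z + \sum_(1 <= r < t.+1) Delta r.-1 x * (X0 r x - X0 r.-1 x)].
Proof.
move=> mu_complete zs; pose n t := \sum_(x <- s) w x * \1_(path_atom t z) x.
have n_gt0 t : 0 < n t.
  rewrite /n (big_rem z)//= indicE mem_set// mulr1 ltr_pwDl// ?pos_s//.
  by apply: sumr_ge0 => x _; rewrite mulr_ge0 ?pmass_ge0// indicE.
pose m t (x : T.-tuple R) := w z / n t * \1_(path_atom t z) x.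
have Fatom t : F t (path_atom t z) by apply: atom_sigma_of; exact: finite_upto.
have mX t k : upto t k -> measurable_fun setT (X k).
  by move=> _; exact: measurable_canonical_process.
have Fm t : sub_measurable (F t) (m t).
  apply/sub_measurableE; apply: measurable_funM => //.
  by apply: measurable_indic; exact: Fatom.
have mm t : measurable_fun setT (m t).
  exact: (sub_measurableW (@mX t) (@Fm t)).
have sum_m t h : (forall x y, path_atom t y x -> h x = h y) ->
    \sum_(x <- s) w x * h x * m t x = w z * h z.
  move=> hC; transitivity (w z * h z / n t * n t); last first.
    by rewrite divfK// gt_eqF.
  rewrite /n mulr_sumr; apply: eq_bigr => x _.
  transitivity (w x * w z / n t * (\1_(path_atom t z) x * h x)).
    by rewrite /m; ring.
  by rewrite (sum_indic_atom_const _ _ hC); ring.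
have martm : is_martingale mu F T m.
  split=> [t _|r t /andP[_ rt] _].
    by split=> //; exact: integrable_finite_support mset1 uniq_s supp_s _ (mm t).
  apply: (is_condexpP mset1 uniq_s supp_s (@mX r) (mm t) (Fm r)) => h hC.
  rewrite (sum_m r h)// (sum_m t h)// => x y xy; apply: hC => k Dk; apply: xy.
  exact: (sub_upto rt).
have [Delta [FDelta rep]] := mu_complete _ martm.
have Em : fine ('E_mu[m 1%N])%E = w z.
  rewrite expectation_finite_support//=.
  have /= := @sum_m 1%N (fun=> 1) (fun _ _ _ => erefl).
  by under eq_bigr do rewrite mulr1; rewrite mulr1.
have n0 : n 0%N = 1.
  rewrite -[RHS](sum_pmass1 mset1 uniq_s supp_s); apply: eq_bigr => x _.
  by rewrite indicE mem_set ?mulr1//; case=> // k /andP[].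
exists Delta, (fun t => w z / n t); split=> //.
- by rewrite n0 divr1.
- rewrite -[RHS](@divff _ (n T)) ?gt_eqF//; congr (_ / _).
  rewrite /n -[LHS](sum_indic_seq uniq_s w zs)//; apply: eq_bigr => x _.
  rewrite !indicE; congr (_ * (nat_of_bool _)%:R).
  by apply/idP/idP => /set_mem => [-> |/path_atom_total ->]; exact: mem_set.
- move=> t x tT xs; have := ae_pmass_gt0 mset1 (rep t tT) (pos_s xs).
  rewrite Em => <-; case: t tT => [|t] tT //=.
  by rewrite Em indicE mem_set ?mulr1 ?n0 ?divr1//; case=> // k /andP[].
Qed.

End finite_complete_market.

(** * Multicausal couplings are martingale measures *)

Section multi_asset.
Context (R : realType) (T N : nat) (mu : 'I_N -> probability (T.-tuple R) R).
Context (S : 'I_N -> seq (T.-tuple R)) (s : seq (N.-tuple (T.-tuple R))).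
Hypothesis uniq_S : forall i, uniq (S i).
Hypothesis supp_S : forall i, mu i (~` [set` S i]) = 0%E.
Hypothesis uniq_s : uniq s.
Hypothesis mem_s : forall x, (x \in s) = [forall i, tnth x i \in S i].

Local Notation Om := (N.-tuple (T.-tuple R)).
Local Notation X := (@canonical_process R T).
Local Notation X0 i := (from0 (mu i) X).

Definition asset_price (k : 'I_N * nat) (x : Om) : R := X k.2 (tnth x k.1).
Definition all_upto t : set ('I_N * nat) := [set k | (1 <= k.2 <= t)%N].
Definition own_upto i t : set ('I_N * nat) :=
  [set k | k.1 = i /\ (1 <= k.2 <= t)%N].
Definition others_upto i t : set ('I_N * nat) :=
  [set k | k.1 <> i /\ (1 <= k.2 <= t)%N].
Definition joint_atom t y := atom_of (all_upto t) asset_price y.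

Lemma measurable_joint_set1 (x : Om) : measurable [set x].
Proof. by apply: measurable_tuple_set1 => u; exact: measurable_path_set1. Qed.

Lemma measurable_asset_price k : measurable_fun setT (asset_price k).
Proof.
rewrite (_ : asset_price k = X k.2 \o (@tnth N _ ^~ k.1))//.
apply: measurableT_comp; first exact: measurable_canonical_process.
exact: measurable_tnth.
Qed.

Lemma finite_all_upto t : finite_set (all_upto t).
Proof.
apply: (@sub_finite_set _ _ ([set: 'I_N] `*` `I_t.+1)).
  by move=> k /andP[_ kt]; split.
by apply: finite_setX => //; exact: finite_II.
Qed.

Lemma finite_own_upto i t : finite_set (own_upto i t).
Proof. by apply: sub_finite_set (finite_all_upto t) => k []. Qed.

Lemma finite_others_upto i t : finite_set (others_upto i t).
Proof. by apply: sub_finite_set (finite_all_upto t) => k []. Qed.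

Lemma own_atomE i t y x :
  atom_of (own_upto i t) asset_price y x <-> path_atom t (tnth y i) (tnth x i).
Proof.
split=> [xy r rt|xy [j r] [/= -> rt]]; first exact: (xy (i, r)).
exact: xy.
Qed.

Lemma joint_atomE t y x :
  joint_atom t y x <-> forall i, path_atom t (tnth y i) (tnth x i).
Proof.
split=> [xy i r rt|xy [j r] /= rt]; first exact: (xy (i, r)).
exact: xy.
Qed.

(** At each time the observation splits into that of asset [i] and that of the
other assets, the two sources of information compared by multicausality. *)
Lemma joint_atom_split i t y :
  joint_atom t y =
  atom_of (others_upto i t) asset_price y `&` atom_of (own_upto i t) asset_price y.
Proof.
apply/seteqP; split=> [x xy|x [xy1 xy2] k kt].
  by split=> k [_ kt]; exact: xy.
by have [ki|/eqP ki] := eqVneq k.1 i; [apply: xy2|apply: xy1].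
Qed.

Lemma sub_joint_atom t r y x : (r <= t)%N -> joint_atom t y x -> joint_atom r y x.
Proof.
move=> rt xy k /andP[k0 kr]; apply: xy; rewrite /all_upto/= k0.
exact: leq_trans rt.
Qed.

Lemma tnth_mem i x : x \in s -> tnth x i \in S i.
Proof. by rewrite mem_s => /forallP. Qed.

Definition increment i t (x : Om) : R := X0 i t.+1 (tnth x i) - X0 i t (tnth x i).

(** The martingale property of all assets for the joint filtration, written on
the atoms of that filtration that meet [s], so that it is a finite system
of linear equations in [w]: these are the dual constraints of the hedging problem. *)
Definition martingale_weight (w : Om -> R) := forall i t y, (t < T)%N -> y \in s ->
  \sum_(x <- s) w x * increment i t x * \1_(joint_atom t y) x = 0.

Lemma gainsE Delta x : gains mu Delta x =
  \sum_(0 <= t < T) \sum_(i < N) tnth (Delta t x) i * increment i t x.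
Proof.
rewrite /gains big_add1; apply: eq_bigr => t _; apply: eq_bigr => i _.
by rewrite /prices !tnth_mktuple.
Qed.

(** An adapted position is constant on the atoms of the joint filtration, on
each of which the next increment has mean zero. *)
Lemma sum_gains_eq0 w Delta : martingale_weight w -> strategies Delta ->
  \sum_(x <- s) w x * gains mu Delta x = 0.
Proof.
move=> mw adDelta; under eq_bigr do rewrite gainsE mulr_sumr.
rewrite exchange_big/= big_nat big1// => t /andP[_ tT].
under eq_bigr do rewrite mulr_sumr.
rewrite exchange_big/= big1// => i _.
under eq_bigr do rewrite mulrCA mulrC.
apply: (sum_atoms_eq0 (D := all_upto t) (X := asset_price)) => [y ys|x y xy].
  exact: mw.
congr (tnth _ i); apply: (sub_measurable_atom _ (adDelta t tT) xy) => u.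
by apply: measurable_tuple_set1 => v; exact: measurable_set1.
Qed.

Lemma sum_indic_marginal i (h : Om -> R) (f : T.-tuple R -> R) :
  \sum_(z <- S i) f z * (\sum_(x <- s) h x * \1_[set x | tnth x i = z] x) =
  \sum_(x <- s) h x * f (tnth x i).
Proof.
under eq_bigr do rewrite mulr_sumr.
rewrite exchange_big/= big_seq [RHS]big_seq; apply: eq_bigr => x xs.
rewrite -(sum_indic_seq (uniq_S i) f (tnth_mem i xs)) mulr_sumr.
by apply: eq_bigr => z _; rewrite mulrCA.
Qed.

Section coupling.
Variable P : probability Om R.
Hypothesis P_marg : forall i A, measurable A ->
  pushforward P (fun x => tnth x i) A = mu i A.

(** Each of the finitely many marginals of [P] is carried by the list [S i]. *)
Lemma coupling_supp : P (~` [set` s]) = 0%E.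
Proof.
apply/negligibleP.
  by apply: measurableC; exact: measurable_seq measurable_joint_set1 _.
have aeS i : {ae P, forall x, tnth x i \in S i}.
  exists ((fun x => tnth x i) @^-1` (~` [set` S i])); split=> //.
  - rewrite -[X in measurable X]setTI; apply: measurable_tnth => //.
    by apply: measurableC; exact: measurable_seq (@measurable_path_set1 R T) _.
  - rewrite -[LHS]/(pushforward P (fun x => tnth x i) (~` [set` S i])).
    rewrite P_marg//.
    by apply: measurableC; exact: measurable_seq (@measurable_path_set1 R T) _.
have := ae_all_seq (enum 'I_N) aeS; apply: filterS => x xS.
by rewrite mem_s; apply/forallP => i; apply: xS; rewrite mem_enum.
Qed.

Lemma sum_marginal i (f : T.-tuple R -> R) :
  \sum_(x <- s) pmass P x * f (tnth x i) = \sum_(z <- S i) pmass (mu i) z * f z.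
Proof.
rewrite -(sum_indic_marginal i (pmass P) f); apply: eq_bigr => z _.
rewrite mulrC; congr (_ * _).
have mz : measurable [set x : Om | tnth x i = z].
  rewrite -[X in measurable X]setTI.
  exact: (measurable_tnth i measurableT (measurable_path_set1 z)).
have := measure_finite_support measurable_joint_set1 uniq_s coupling_supp mz.
rewrite -[LHS]/(pushforward P (fun x => tnth x i) [set z]).
rewrite P_marg; last exact: measurable_path_set1.
by rewrite -pmassE; [case|exact: measurable_path_set1].
Qed.

(** Write [C] for the event that asset [i] has the past of [y], [B] for the event
that the other assets do, and [A z] for the event that asset [i] follows the
full path [z]. Conditional independence says
[P C * P (A z & B & C) = P (A z & C) * P (B & C)]. Summing over [z] against the
next increment of [z] makes the right-hand side vanish, because [mu i] is a
martingale measure; so the increment of asset [i] has mean zero on [B & C]. *)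
Lemma multicausal_martingale_weight :
  (forall i, is_martingale (mu i) (@canonical_filtration R T) T X) ->
  multicausal P -> martingale_weight (pmass P).
Proof.
move=> mart_mu mcP i t y tT _.
pose v (z : T.-tuple R) := X0 i t.+1 z - X0 i t z.
set w := pmass P.
under eq_bigr do rewrite /increment -/(v _).
have vmean : \sum_(x <- s) w x * (\1_(path_atom t (tnth y i)) (tnth x i) *
    v (tnth x i)) = 0.
  rewrite (sum_marginal i (fun z => \1_(path_atom t (tnth y i)) z * v z)).
  have := finite_martingale (uniq_S i) (supp_S i) (tnth y i) (mart_mu i) tT.
  by under eq_bigr do rewrite -mulrA.
(* At time 0 the joint atom is the whole space, and the marginal suffices. *)
have [t0|t_gt0] := posnP t.
  rewrite -[RHS]vmean; apply: eq_bigr => x _.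
  have atom0 (U : Type) (I : Type) D (Z : I -> U -> R) u u' :
      (forall k, ~ D k) -> \1_(atom_of D Z u) u' = 1 :> R.
    by move=> D0; rewrite indicE mem_set// => k /D0.
  rewrite !atom0 ?mul1r ?mulr1//.
  - by move=> k; rewrite t0 /upto/=; case: k.
  - by move=> [j k]; rewrite t0 /all_upto/=; case: k.
have fo := finite_own_upto i t; have ft := finite_others_upto i t.
pose C := atom_of (own_upto i t) asset_price y.
pose B := atom_of (others_upto i t) asset_price y.
pose A z : set Om := [set x | tnth x i = z].
have masset D k : D k -> measurable_fun setT (asset_price k).
  by move=> _; exact: measurable_asset_price.
have sA z : info [set k | k.1 = i /\ (1 <= k.2 <= T)%N] (A z).
  rewrite (_ : A z = atom_of (own_upto i T) asset_price [tuple z | _ < N]).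
    by apply: atom_sigma_of; exact: finite_own_upto.
  apply/seteqP; split=> x; rewrite own_atomE tnth_mktuple.
    by move=> ->.
  exact: path_atom_total.
have sB : info [set k | k.1 <> i /\ (1 <= k.2 <= t)%N] B by exact: atom_sigma_of.
have mA z : measurable (A z).
  exact: (sigma_of_measurable (@masset (own_upto i T)) (sA z)).
have mB : measurable B.
  exact: (sigma_of_measurable (@masset (others_upto i t)) sB).
pose n := \sum_(x <- s) w x * \1_C x.
pose E (f : Om -> R) := \sum_(x <- s) w x * \1_C x * f x.
have indep z : n * E \1_(A z `&` B) = E \1_(A z) * E \1_B.
  have t1T : (1 <= t <= T)%N by rewrite t_gt0 ltnW.
  have [a [b [ca cb cab]]] := mcP i t t1T _ _ (sA z) sB.
  have atomE f g : is_condexp P (sigma_of (own_upto i t) asset_price) f g ->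
      measurable_fun setT f -> g y * n = E f.
    exact: (is_condexp_atom measurable_joint_set1 uniq_s coupling_supp fo (@masset _)).
  rewrite -(atomE _ _ ca) -?(atomE _ _ cb) -?(atomE _ _ cab); first by rewrite /=; ring.
  - by apply: measurable_indic; exact: measurableI.
  - exact: measurable_indic.
  - exact: measurable_indic.
have EB f : E (fun x => \1_B x * f x) =
    \sum_(x <- s) w x * f x * \1_(joint_atom t y) x.
  apply: eq_bigr => x _; rewrite (joint_atom_split i) indicI/= -/B -/C.
  ring.
have nL : n * \sum_(x <- s) w x * v (tnth x i) * \1_(joint_atom t y) x = 0.
  rewrite -EB /E.
  under eq_bigr do rewrite mulrA.
  rewrite -(sum_indic_marginal i (fun x => w x * \1_C x * \1_B x) v).
  rewrite mulr_sumr.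
  transitivity (\sum_(z <- S i) v z * (E \1_(A z) * E \1_B)).
    apply: eq_bigr => z _; rewrite mulrCA -indep; congr (_ * (_ * _)).
    by apply: eq_bigr => x _; rewrite -mulrA indicI/= [_ * \1_B x]mulrC.
  under eq_bigr do rewrite mulrA.
  rewrite -mulr_suml (sum_indic_marginal i (fun x => w x * \1_C x) v).
  rewrite (_ : \sum_(_ <- _) _ = 0) ?mul0r// -[RHS]vmean.
  apply: eq_bigr => x _; rewrite -mulrA; congr (_ * (_ * _)).
  rewrite !indicE; congr (nat_of_bool _)%:R.
  by apply/idP/idP => /set_mem/own_atomE/mem_set.
(* If P C = 0, no listed point of C has mass, so the sum has only zero terms. *)
have [n0|n0] := eqVneq n 0; last first.
  by move/eqP: nL; rewrite mulf_eq0 (negbTE n0) => /eqP.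
rewrite big_seq big1// => x xs.
rewrite (joint_atom_split i) indicI/= -/B -/C.
suff wC : w x * \1_C x = 0.
  transitivity (w x * \1_C x * (v (tnth x i) * \1_B x)); first by ring.
  by rewrite wC mul0r.
apply/eqP; move/eqP: n0; rewrite /n psumr_eq0.
  by move=> /allP/(_ x xs).
by move=> k _; rewrite mulr_ge0 ?pmass_ge0// indicE.
Qed.

End coupling.

End multi_asset.

(** * Martingale measures are multicausal couplings *)

(** The sum of the Dirac masses weighted by [q], normalised by its total mass
[1] in order to be a probability by construction. *)
Lemma finite_probability_exists d (Om : measurableType d) (R : realType)
    (s : seq Om) (q : Om -> R) :
  (forall x : Om, measurable [set x]) -> uniq s ->
  (forall x, 0 <= q x) -> \sum_(x <- s) q x = 1 ->
  exists2 P : probability Om R, P (~` [set` s]) = 0%E &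
    forall x, x \in s -> pmass P x = q x.
Proof.
move=> mset1 us q0 q1; have q0n x : 0 <= q x by exact: q0.
pose m : {measure set Om -> \bar R} := msum (fun k => mscale (NngNum (q0n (nth point s k)))
                                (@dirac _ Om (nth point s k) R)) (size s).
have mE U : m U = (\sum_(x <- s) q x * \1_U x)%:E.
  rewrite /m /msum (big_nth point) big_mkord -sumEFin; apply: eq_bigr => k _.
  by rewrite /= /mscale/= diracE indicE EFinM.
have m1 : m setT = 1%E.
  by rewrite mE; under eq_bigr do rewrite indicT mulr1; rewrite q1.
exists (mnormalize m (dirac point)).
  rewrite /= /mnormalize m1 /= onee_eq0/= mE big_seq big1 ?mul0e// => x xs.
  by rewrite indicE memNset ?mulr0//=; apply.
move=> x xs; rewrite /pmass /= /mnormalize m1 /= onee_eq0/= invr1 mule1 mE.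
rewrite -[RHS](sum_indic_seq us q xs)/=; apply: eq_bigr => y _.
rewrite !indicE; congr (_ * (nat_of_bool _)%:R).
by apply/idP/idP => /set_mem => ->; exact: mem_set.
Qed.

Section strong_direction.
Context (R : realType) (T N : nat) (mu : 'I_N -> probability (T.-tuple R) R).
Context (S : 'I_N -> seq (T.-tuple R)) (s : seq (N.-tuple (T.-tuple R))).
Hypothesis uniq_S : forall i, uniq (S i).
Hypothesis pos_S : forall i z, z \in S i -> 0 < pmass (mu i) z.
Hypothesis supp_S : forall i, mu i (~` [set` S i]) = 0%E.
Hypothesis uniq_s : uniq s.
Hypothesis mem_s : forall x, (x \in s) = [forall i, tnth x i \in S i].
Hypothesis mu_complete : forall i, complete_market (mu i).

Local Notation Om := (N.-tuple (T.-tuple R)).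
Local Notation X := (@canonical_process R T).
Local Notation X0 i := (from0 (mu i) X).
Local Notation price := (@asset_price R T N).

Lemma sub_measurable_path_atom t (f : T.-tuple R -> R) :
  sub_measurable (canonical_filtration t) f ->
  forall x y, path_atom t y x -> f x = f y.
Proof.
by move=> mf x y xy; apply: (sub_measurable_atom _ mf xy) => u; exact: measurable_set1.
Qed.

(** For a probability [w], this says that the conditional law of the path of asset
[i] given the joint past up to time [t] is the one under [mu i] given the past
of asset [i]: the increments after time [t] of the replicating integrals
average to zero against functions of the joint past. Here
[kappa z t * 1_(path_atom t z)] is the conditional probability of [z]. At time
[0] this identifies the marginal; at later times it yields multicausality. *)
Lemma conditional_future w i : martingale_weight mu s w ->
  exists kappa : T.-tuple R -> nat -> R,
    (forall z, z \in S i -> kappa z 0%N = pmass (mu i) z) /\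
    forall t (f : T.-tuple R -> R) (h : Om -> R), (t <= T)%N ->
      (forall x y, joint_atom t y x -> h x = h y) ->
      \sum_(x <- s) w x * h x * f (tnth x i) =
      \sum_(x <- s) w x * h x * \sum_(z <- S i) f z * kappa z t *
        \1_(path_atom t z) (tnth x i).
Proof.
move=> mw.
(* Off the list S i nothing is required, so a choice function exists. *)
pose replicates z (dk : (nat -> T.-tuple R -> R) * (nat -> R)) := [/\
    forall t, (t < T)%N -> sub_measurable (@canonical_filtration R T t) (dk.1 t),
    dk.2 0%N = pmass (mu i) z, dk.2 T = 1 &
    forall t x, (t <= T)%N -> x \in S i ->
      dk.2 t * \1_(path_atom t z) x = pmass (mu i) z +
        \sum_(1 <= r < t.+1) dk.1 r.-1 x * (X0 i r x - X0 i r.-1 x)].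
have /choice[Dk hDk] : forall z, exists dk, z \in S i -> replicates z dk.
  move=> z; have [zs|zs] := boolP (z \in S i); last by exists (fun _ _ => 0, fun=> 0).
  have [Delta [kappa H]] := indicator_replication (uniq_S i) (@pos_S i)
    (supp_S i) (@mu_complete i) zs.
  by exists (Delta, kappa).
exists (fun z => (Dk z).2); split=> [z /hDk[]//|t f h tT hC].
have key z : z \in S i ->
    \sum_(x <- s) w x * h x * ((Dk z).2 t * \1_(path_atom t z) (tnth x i)) =
    \sum_(x <- s) w x * h x * \1_[set z] (tnth x i).
  move=> zS; have [FD _ k1 rep] := hDk z zS.
  apply/eqP; rewrite -subr_eq0 -opprB oppr_eq0 -sumrB; apply/eqP.
  (* The payoff minus its price at time t is a sum of later trading gains. *)
  transitivity (\sum_(x <- s) \sum_(t.+1 <= r < T.+1)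
      w x * increment mu i r.-1 x * (h x * (Dk z).1 r.-1 (tnth x i))).
    rewrite big_seq [RHS]big_seq; apply: eq_bigr => x xs.
    have xS := tnth_mem mem_s i xs.
    have -> : \1_[set z] (tnth x i) = (Dk z).2 T * \1_(path_atom T z) (tnth x i).
      rewrite k1 mul1r !indicE; congr (nat_of_bool _)%:R.
      by apply/idP/idP => /set_mem => [->|/path_atom_total ->]; exact: mem_set.
    rewrite -mulrBr !rep// (@big_cat_nat _ _ _ t.+1 1%N T.+1)//=.
    rewrite opprD addrACA subrr add0r addrAC subrr add0r mulr_sumr.
    apply: eq_big_nat => r /andP[tr _].
    by rewrite /increment prednK ?(leq_trans _ tr)//; ring.
  rewrite exchange_big/= big_nat big1// => r /andP[tr rT].
  have rT' : (r.-1 < T)%N by case: r tr rT.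
  apply: (sum_atoms_eq0 (D := all_upto r.-1)
    (X := price)) => [y ys|x y xy].
    exact: mw.
  have /joint_atomE xyi := xy.
  rewrite (sub_measurable_path_atom (FD _ rT') (xyi i)).
  rewrite (hC x y)//; apply: sub_joint_atom xy.
  by rewrite -ltnS prednK// (leq_trans _ tr).
transitivity (\sum_(z <- S i) f z * \sum_(x <- s) w x * h x * \1_[set z] (tnth x i)).
  under [RHS]eq_bigr do rewrite mulr_sumr.
  rewrite exchange_big/= big_seq [RHS]big_seq; apply: eq_bigr => x xs.
  rewrite -[in LHS](sum_indic_seq (uniq_S i) f (tnth_mem mem_s i xs)) mulr_sumr.
  by apply: eq_bigr => z _; rewrite mulrCA.
under [RHS]eq_bigr do rewrite mulr_sumr.
rewrite exchange_big/= big_seq [RHS]big_seq; apply: eq_bigr => z zS.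
rewrite -key// mulr_sumr; apply: eq_bigr => x _; ring.
Qed.

Section martingale_weight_coupling.
Variable P : probability Om R.
Hypothesis supp_P : P (~` [set` s]) = 0%E.
Hypothesis mart_P : martingale_weight mu s (pmass P).

(** The conditional law at time [0], where the joint past is trivial. *)
Lemma martingale_weight_marginal i A : measurable A ->
  pushforward P (fun x => tnth x i) A = mu i A.
Proof.
move=> mA; have [kappa [kappa0 hk]] := conditional_future i mart_P.
have mpre : measurable ((fun x : Om => tnth x i) @^-1` A).
  by rewrite -[X in measurable X]setTI; exact: measurable_tnth.
rewrite /pushforward.
rewrite (measure_finite_support (@measurable_joint_set1 R T N) uniq_s supp_P)//.
rewrite (measure_finite_support (@measurable_path_set1 R T) (uniq_S i) (supp_S i))//.
congr EFin; have := hk 0%N \1_A (fun=> 1) (leq0n T) (fun _ _ _ => erefl).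
under eq_bigr do rewrite mulr1; move=> /= e; rewrite [LHS]e.
under eq_bigr do rewrite mulr1.
have atom0 z x : \1_(path_atom 0 z) x = 1 :> R.
  by rewrite indicE mem_set//; case=> // k /andP[].
under eq_bigr do under eq_bigr do rewrite atom0 mulr1.
rewrite -mulr_suml (sum_pmass1 (@measurable_joint_set1 R T N) uniq_s supp_P).
rewrite mul1r big_seq [RHS]big_seq; apply: eq_bigr => z zS.
by rewrite kappa0// mulrC.
Qed.

(** [a], the conditional probability of [A] given the past of asset [i], is
also its conditional probability given the joint past. For [h] depending on the
past of asset [i], this gives [E[h a b] = E[h a 1_B] = E[h 1_A 1_B]], using
first that [b] is the conditional probability of [B] and then that [h 1_B]
depends on the joint past. *)
Lemma martingale_weight_multicausal : multicausal P.
Proof.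
move=> i t /andP[t1 tT] A B FA FB.
have mset1 := @measurable_joint_set1 R T N.
have masset D k : D k -> measurable_fun setT (price k).
  by move=> _; exact: measurable_asset_price.
have fo := finite_own_upto i t.
have [kappa [_ hk]] := conditional_future i mart_P.
(* The event A depends on the path of asset i only, so it may be evaluated at
   the tuple all of whose entries are that path. *)
pose cst_path (z : T.-tuple R) : Om := [tuple z | _ < N].
have own_cst r z x : atom_of (own_upto i r) price (cst_path z) x <->
    path_atom r z (tnth x i) by rewrite own_atomE tnth_mktuple.
pose own_atom := atom_of (own_upto i t) price.
have joint_own h : (forall x y, own_atom y x -> h x = h y) ->
    forall x y, joint_atom t y x -> h x = h y :> R.
  move=> hC x y xy; apply: hC; move: xy; rewrite (joint_atom_split i).
  by case.
have mA : measurable A by exact: sigma_of_measurable (@masset _) _ FA.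
have mB : measurable B by exact: sigma_of_measurable (@masset _) _ FB.
pose a x := \sum_(z <- S i)
  \1_A (cst_path z) * kappa z t * \1_(own_atom (cst_path z)) x.
have Ga : sub_measurable (sigma_of (own_upto i t) price) a.
  by apply: sub_measurable_sum_indic => z; exact: atom_sigma_of.
have aC x y : own_atom y x -> a x = a y.
  by move=> xy; apply: (sub_measurable_atom _ Ga xy) => u; exact: measurable_set1.
have sum_a h : (forall x y, joint_atom t y x -> h x = h y) ->
    \sum_(x <- s) pmass P x * h x * a x = \sum_(x <- s) pmass P x * h x * \1_A x.
  move=> hC; have := hk t (fun z => \1_A (cst_path z)) h tT hC.
  move=> /esym e; transitivity (\sum_(x <- s) pmass P x * h x *
      \sum_(z <- S i)
        \1_A (cst_path z) * kappa z t * \1_(path_atom t z) (tnth x i)).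
    apply: eq_bigr => x _; congr (_ * _); apply: eq_bigr => z _; congr (_ * _).
    rewrite !indicE; congr (nat_of_bool _)%:R.
    by apply/idP/idP => /set_mem/own_cst/mem_set.
  rewrite [LHS]e; apply: eq_bigr => x _; congr (_ * _).
  apply/esym; apply: (indic_sigma_of_atom FA).
  by apply/own_cst.
have [b Gb hb] := finite_condexp_exists P s price fo \1_B.
exists a, b; split.
- apply: (is_condexpP mset1 uniq_s supp_P (@masset _) _ Ga) => [|h /joint_own hC].
    exact: measurable_indic.
  exact: sum_a.
- apply: (is_condexpP mset1 uniq_s supp_P (@masset _) _ Gb hb).
  exact: measurable_indic.
- apply: (is_condexpP mset1 uniq_s supp_P (@masset _)) => [||h hC].
  + by apply: measurable_indic; exact: measurableI.
  + apply/sub_measurableE; apply: measurable_funM; exact/sub_measurableE.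
  + have hb' := hb (fun x => h x * a x).
    transitivity (\sum_(x <- s) pmass P x * (h x * a x) * b x).
      by apply: eq_bigr => x _ /=; ring.
    rewrite hb'; last by move=> x y xy; rewrite (hC x y xy) (aC x y xy).
    transitivity (\sum_(x <- s) pmass P x * (h x * \1_B x) * a x).
      by apply: eq_bigr => x _ /=; ring.
    rewrite (sum_a (fun x => h x * \1_B x)).
      by apply: eq_bigr => x _; rewrite indicI/=; ring.
    move=> x y xy; rewrite (joint_own h hC x y xy); congr (_ * _).
    apply: (indic_sigma_of_atom FB); move: xy; rewrite (joint_atom_split i).
    by case.
Qed.

Lemma martingale_weight_Cpl_mc : Cpl_mc mu P.
Proof.
split; first exact: martingale_weight_marginal.
exact: martingale_weight_multicausal.
Qed.

End martingale_weight_coupling.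

End strong_direction.

(** * Duality *)

Lemma tuples_in_seqs (A : choiceType) (N : nat) (S : 'I_N -> seq A) :
  exists2 s : seq (N.-tuple A), uniq s &
    forall x, (x \in s) = [forall i, tnth x i \in S i].
Proof.
pose U := flatten [seq S i | i <- enum 'I_N].
have SU i z : z \in S i -> z \in U.
  move=> zS; apply/flattenP; exists (S i) => //.
  by apply/mapP; exists i; rewrite ?mem_enum.
pose r := [seq [tuple of map val u] | u : N.-tuple (seq_sub U)].
exists [seq x <- undup r | [forall i, tnth x i \in S i]].
  by rewrite filter_uniq// undup_uniq.
move=> x; rewrite mem_filter mem_undup.
have [/forallP xS|//] := boolP [forall i, tnth x i \in S i].
rewrite andTb; apply/fintype.imageP; exists [tuple SeqSub (SU i _ (xS i)) | i < N] => //.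
by apply: eq_from_tnth => i; rewrite tnth_map tnth_mktuple.
Qed.

Lemma ereal_lt_between (R : realFieldType) (x y : \bar R) : (x < y)%E ->
  exists p : R, (x < p%:E < y)%E.
Proof.
case: x y => [x| |] [y| |] // xy.
- by exists ((x + y) / 2); move: xy; rewrite !lte_fin => xy; apply/andP; split; lra.
- by exists (x + 1); rewrite lte_fin ltrDl ltr01 ltry.
- by exists (y - 1); rewrite ltNyr lte_fin gtrBl ltr01.
- by exists 0; rewrite ltNyr ltry.
Qed.

Section duality.
Context (R : realType) (T N : nat) (mu : 'I_N -> probability (T.-tuple R) R).
Context (S : 'I_N -> seq (T.-tuple R)) (s : seq (N.-tuple (T.-tuple R))).
Hypothesis uniq_S : forall i, uniq (S i).
Hypothesis pos_S : forall i z, z \in S i -> 0 < pmass (mu i) z.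
Hypothesis supp_S : forall i, mu i (~` [set` S i]) = 0%E.
Hypothesis uniq_s : uniq s.
Hypothesis mem_s : forall x, (x \in s) = [forall i, tnth x i \in S i].
Context (xi : N.-tuple (T.-tuple R) -> R).
Hypothesis xi_meas : measurable_fun setT xi.

Local Notation Om := (N.-tuple (T.-tuple R)).

Lemma expectation_coupling (P : probability Om R) : P (~` [set` s]) = 0%E ->
  'E_P[xi]%E = (\sum_(x <- s) pmass P x * xi x)%:E.
Proof.
move=> suppP; rewrite unlock.
rewrite (integral_finite_support (@measurable_joint_set1 R T N) uniq_s suppP)//.
by under eq_bigr do rewrite indicT mulr1.
Qed.

(** Trading gains have mean zero under every multicausal coupling, and a
quasi-sure inequality holds at every point of positive mass. *)
Lemma weak_duality (P : probability Om R) p0 Delta :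
  (forall i, is_martingale (mu i) (@canonical_filtration R T) T
                           (@canonical_process R T)) ->
  Cpl_mc mu P -> strategies Delta ->
  quasi_surely mu (fun x => p0 + gains mu Delta x >= xi x) ->
  ('E_P[xi] <= p0%:E)%E.
Proof.
move=> mart_mu CP adDelta [B [mB BP] hedge].
have [P_marg mcP] := CP.
have suppP := coupling_supp supp_S mem_s P_marg.
rewrite expectation_coupling// lee_fin.
have mw := multicausal_martingale_weight uniq_S supp_S uniq_s mem_s P_marg
  mart_mu mcP.
have gains0 := sum_gains_eq0 mw adDelta.
rewrite -[leRHS]mul1r.
rewrite -(sum_pmass1 (@measurable_joint_set1 R T N) uniq_s suppP).
rewrite mulr_suml -[leRHS]addr0 -[X in _ <= _ + X]gains0 -big_split/=.
apply: ler_sum => x _; rewrite -mulrDr.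
have [xB|xB] := pselect (B x); last by rewrite ler_wpM2l ?pmass_ge0// hedge.
have -> : pmass P x = 0; last by rewrite !mul0r.
rewrite /pmass (subset_measure0 (measurable_joint_set1 x) mB _ (BP P CP))//.
by move=> _ ->.
Qed.

(** The two alternatives of Farkas' lemma for the hedging inequalities at the
points of [s]. The unknowns are the positions held in asset [i] at time [t] on
the joint atom of each listed point; a certificate of infeasibility is
orthogonal to all gains, hence normalises to a martingale weight, whose
expectation of [xi] exceeds [p0]. *)
Lemma hedge_or_coupling p0 : (forall i, complete_market (mu i)) ->
  (exists2 Delta, strategies Delta &
    forall x, x \in s -> xi x <= p0 + gains mu Delta x) \/
  (exists2 P, Cpl_mc mu P & (p0%:E < 'E_P[xi])%E).
Proof.
move=> mu_complete; pose pt := tnth (in_tuple s).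
have /tuple_uniqP injpt : uniq (in_tuple s) by [].
pose J : finType := ('I_T * 'I_N * 'I_(size s))%type.
have [[v hv]|[q [q0 qa qb]]] := @farkas R 'I_(size s) J
    (fun k j => increment mu j.1.2 j.1.1 (pt k) * \1_(joint_atom j.1.1 (pt j.2)) (pt k))
    (fun k => xi (pt k) - p0).
- left.
  pose Delta t (x : Om) : N.-tuple R := [tuple \sum_(l < size s)
    oapp (fun t' : 'I_T => v (t', i, l)) 0 (insub t) *
    \1_(joint_atom t (pt l)) x | i < N].
  exists Delta.
    move=> t tT; apply/sub_measurableE/measurable_fun_tnthP => i.
    apply/sub_measurableE.
    rewrite (_ : _ \o _ = fun x => \sum_(l < size s)
        oapp (fun t' : 'I_T => v (t', i, l)) 0 (insub t) *
        \1_(joint_atom t (pt l)) x); last first.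
      by apply/funext => x /=; rewrite tnth_mktuple.
    apply: sub_measurable_sum_indic => l; apply: atom_sigma_of.
    exact: finite_all_upto.
  move=> x xs; have [k ->] : exists k, x = pt k by exact/tnthP.
  rewrite -lerBlDl (le_trans (hv k))// gainsE big_mkord.
  rewrite (_ : \sum_j _ = \sum_(t < T) \sum_(i < N) \sum_(l < size s)
      increment mu i t (pt k) * \1_(joint_atom t (pt l)) (pt k) * v (t, i, l)).
    2: by rewrite !pair_bigA/=; apply: eq_bigr => -[[t i] l] _.
  apply: ler_sum => t _; apply: ler_sum => i _.
  rewrite tnth_mktuple mulr_suml; apply: ler_sum => l _.
  by rewrite valK/=; rewrite le_eqVlt; apply/orP; left; apply/eqP; ring.
- right; pose Q := \sum_k q k.
  (* The certificate pairs to a positive number, so it is not identically zero. *)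
  have Q0 : 0 < Q.
    rewrite lt_neqAle sumr_ge0// andbT eq_sym; apply/eqP => Q0.
    move: qb; rewrite big1 ?ltxx// => k _.
    have := Q0; move/eqP; rewrite psumr_eq0// => /allP/(_ k).
    by rewrite mem_index_enum => /(_ isT)/eqP ->; rewrite mul0r.
  pose w x := (\sum_(k | pt k == x) q k) / Q.
  have wpt k : w (pt k) = q k / Q.
    rewrite /w (bigD1 k)//= big1 ?addr0// => l /andP[/eqP lk].
    by rewrite (injpt _ _ lk) eqxx.
  have sumw (f : Om -> R) : \sum_(x <- s) w x * f x = (\sum_k q k * f (pt k)) / Q.
    rewrite big_tnth mulr_suml; apply: eq_bigr => k _.
    by rewrite -/(pt k) wpt; ring.
  have w0 x : 0 <= w x by rewrite divr_ge0 ?sumr_ge0// ltW.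
  have w1 : \sum_(x <- s) w x = 1.
    have := sumw (fun=> 1); under eq_bigr do rewrite mulr1.
    by move=> ->; under eq_bigr do rewrite mulr1; rewrite divff// gt_eqF.
  have [P suppP wP] :=
    finite_probability_exists (@measurable_joint_set1 R T N) uniq_s w0 w1.
  have sumP (f : Om -> R) : \sum_(x <- s) pmass P x * f x = (\sum_k q k * f (pt k)) / Q.
    by rewrite -sumw big_seq [RHS]big_seq; apply: eq_bigr => x /wP ->.
  exists P.
    apply: (martingale_weight_Cpl_mc uniq_S pos_S supp_S uniq_s mem_s mu_complete suppP).
    move=> i t y tT ys; have [l ->] : exists l, y = pt l by exact/tnthP.
    under eq_bigr do rewrite -mulrA.
    by rewrite sumP (qa (Ordinal tT, i, l)) mul0r.
  rewrite expectation_coupling// lte_fin sumP ltr_pdivlMr// mulr_sumr -subr_gt0.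
  rewrite -sumrB; move: qb; congr (_ < _); apply: eq_bigr => k _; ring.
Qed.

End duality.

Theorem theorem3p6 (R : realType) (T N : nat)
    (T_gt0 : (0 < T)%N) (N_gt0 : (0 < N)%N)
    (mu : 'I_N -> probability (T.-tuple R) R)
    (mu_mart : forall i, is_martingale (mu i) (@canonical_filtration R T) T
                                       (@canonical_process R T))
    (mu_complete : forall i, complete_market (mu i))
    (xi : N.-tuple (T.-tuple R) -> R)
    (xi_meas : measurable_fun setT xi)
    (xi_bound : exists f : 'I_N -> T.-tuple R -> R,
       (forall i, (mu i).-integrable setT (EFin \o f i)) /\
       (forall x, xi x <= \sum_(i < N) f i (tnth x i))) :
  superhedging_price mu xi = ereal_sup [set ('E_P[xi])%E | P in Cpl_mc mu].
Proof.
have [S hS] := choice (fun i => finite_support_exists (@mu_complete i)).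
have uS i : uniq (S i) by case: (hS i).
have pS i z : z \in S i -> 0 < pmass (mu i) z by case: (hS i) => _ + _; exact.
have sS i : mu i (~` [set` S i]) = 0%E by case: (hS i).
have [s us ms] := tuples_in_seqs S.
apply/eqP; rewrite eq_le; apply/andP; split; last first.
  apply: ge_ereal_sup => _ [P CP <-]; apply: le_ereal_inf_tmp.
  move=> _ [p0 [Delta adDelta hedge] <-].
  exact: (weak_duality uS sS us ms xi_meas mu_mart CP adDelta hedge).
rewrite leNgt; apply/negP => /ereal_lt_between[p0 /andP[supp0 p0inf]].
have [[Delta adDelta hedge]|[P CP p0P]] :=
  hedge_or_coupling uS pS sS us ms xi_meas p0 mu_complete.
- move: p0inf; rewrite ltNge => /negP; apply; apply: ereal_inf_lbound.
  exists p0 => //; exists Delta => //; exists (~` [set` s]).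
    split.
      by apply: measurableC; exact: measurable_seq (@measurable_joint_set1 R T N) _.
    by move=> P [P_marg _]; exact: (coupling_supp sS ms P_marg).
  by move=> x /contrapT xs; exact: hedge.
- move: supp0; rewrite ltNge => /negP; apply; apply: le_trans (ltW p0P) _.
  by apply: ereal_sup_ubound; exists P.
Qed.
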